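(* There exist $\Lambda>1$, $\alpha\in(0,2)$ and $\theta_1,\theta_2>0$ such that $c_{\theta_1}\neq c_{\theta_2}$.
   Context: Given $\Lambda>1$ and $\alpha\in(0,2)$, let $p_\uparrow,p_\downarrow>0$ be determined by $p_\uparrow+p_\downarrow=1$ and $p_\downarrow/p_\uparrow=\Lambda^\alpha$. Let $L=(L_n)_{n\ge0}$ be the Markov chain on $\{0,1,2,\dots\}$ started at $L_0=0$ that from $0$ jumps to $1$ with probability $1$, and from $j>0$ jumps to $j+1$ with probability $p_\uparrow$ and to $j-1$ with probability $p_\downarrow$. Let $\tau_0:=\min\{j>0:L_j=0\}$ and $Z:=\sum_{j=0}^{\tau_0-1}\Lambda^{2L_j}$, with characteristic function $\varphi_Z$. For $\theta\in\mathbb R\setminus\{0\}$ put $$c_\theta:=\lim_{n\to\infty}\frac{1-\varphi_Z(\theta/\Lambda^{2n})}{|\theta/\Lambda^{2n}|^{\alpha/2}}\in\mathbb C ;$$ this limit exists for all $\theta\ne0$ (and depends on $\Lambda$ and $\alpha$). *)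

(* Defs.v *)
From mathcomp Require Import all_boot all_order all_algebra.
From mathcomp Require Import complex.
From mathcomp Require Import all_classical all_reals all_analysis.

Set Implicit Arguments.
Unset Strict Implicit.
Unset Printing Implicit Defensive.

Import Order.TTheory GRing.Theory Num.Theory.
Import numFieldNormedType.Exports.

Local Open Scope classical_set_scope.
Local Open Scope ring_scope.
Local Open Scope complex_scope.

Definition cond_prob (R : realType) (d : measure_display)
    (Omega : measurableType d) (P : probability Omega R)
    (B A : set Omega) : R :=
  fine (P (B `&` A)) / fine (P A).

(* Only the values [x 0, ..., x n] of the history [x] are constrained. *)
Definition is_markov_chain (R : realType) (d : measure_display)
    (Omega : measurableType d) (P : probability Omega R)
    (x0 : nat) (p : nat -> nat -> R) (L : nat -> {RV P >-> nat}) : Prop :=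
  P [set w | L 0%N w = x0] = 1%E /\
  forall (n : nat) (x : nat -> nat) (y : nat),
    P [set w | forall i, (i <= n)%N -> L i w = x i] != 0%E ->
    cond_prob P [set w | L n.+1 w = y]
                [set w | forall i, (i <= n)%N -> L i w = x i] = p (x n) y.

Definition transition (R : realType) (pup pdown : R) (j k : nat) : R :=
  if j == 0%N then (k == 1%N)%:R
  else if k == j.+1 then pup
  else if k == j.-1 then pdown
  else 0.

(* A path that never returns to 0 gets the junk value 0; for the chain at hand
   (pdown > pup) such paths form a null event. *)
Definition tau0 (l : nat -> nat) : nat :=
  if pselect (exists j, (0 < j)%N && (l j == 0%N)) is left returns
  then ex_minn returns else 0%N.

Definition excursion_sum (R : realType) (Lambda : R) (l : nat -> nat) : R :=
  \sum_(0 <= j < tau0 l) Lambda ^+ (2 * l j).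

Definition char_fun (R : realType) (d : measure_display)
    (Omega : measurableType d) (P : probability Omega R)
    (X : Omega -> R) (t : R) : R[i] :=
  fine 'E_P[fun w => cos (t * X w)] +i* fine 'E_P[fun w => sin (t * X w)].

(* The codomain is written [R[i]^o] so that limits are taken in the topology
   induced by the complex modulus. *)
Definition c_seq (R : realType) (Lambda alpha : R) (phi : R -> R[i])
    (theta : R) (n : nat) : R[i]^o :=
  (1 - phi (theta / Lambda ^+ (2 * n))) /
  (`|theta / Lambda ^+ (2 * n)| `^ (alpha / 2))%:C.

Definition c_theta (R : realType) (Lambda alpha : R) (phi : R -> R[i])
    (theta : R) : R[i]^o :=
  limn (c_seq Lambda alpha phi theta).

(* Main.v *)
Require Import Defs.
From mathcomp Require Import all_boot all_order all_algebra.
From mathcomp Require Import complex.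
From mathcomp Require Import all_classical all_reals all_analysis.
From mathcomp Require Import measurable_realfun.
From mathcomp Require Import zify ring lra.
Import Order.TTheory GRing.Theory Num.Theory.
Import numFieldNormedType.Exports.
Local Open Scope classical_set_scope.
Local Open Scope ring_scope.
Local Open Scope complex_scope.
Import Normc.

(** The limit is computed approximately for [Lambda = 101] and [alpha = 1], a
    regime in which the excursion 0, 1, 0 has probability close to 1.

    The part of an excursion lying above level 1 is a geometric number of scaled
    copies of the excursion, so the characteristic function [phi] of [Z] satisfies
      [phi t * (1 - pup * phi (Lambda^2 t)) = pdown * exp (i (1 + Lambda^2) t)]
    ([char_fun_functional]). It is obtained from the history of the chain by
    induction on the number of remaining steps ([chf_on_hist]), which approximates
    [phi] geometrically fast by a deterministic first-passage recursion, and from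
    a contraction estimate for bounded solutions of that recursion ([walk_decay]),
    which replaces both recurrence and the strong Markov property.

    With [u = 1 - phi], [q = pup / pdown = Lambda^-alpha] this becomes
      [u t * (1 + q * u (Lambda^2 t)) =
         q * u (Lambda^2 t) + 1 - exp (i (1 + Lambda^2) t)].
    Along [t = theta / Lambda^(2n)] the sequence [v_n = u / q^n] has increments of
    order [q^(n+1)] ([recursion_limit]); hence it converges, and its limit is
    within order [q] of [v_0 = u theta], itself within order [q] of [1 - exp (i s)]
    where [s = theta (1 + Lambda^2)]. So [c_theta * sqrt theta] is close to
    [1 - exp (i s)] ([c_theta_approx]): its real part is near 2 for [s = pi] and
    near 0 for [s = 2 pi], and the two values of [c_theta] differ. *)

Set Implicit Arguments.
Unset Strict Implicit.
Unset Printing Implicit Defensive.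

(** * Complex modulus and the unit circle *)

Section complex_facts.
Context {R : realType}.
Implicit Types (t : R) (z : R[i]).

Lemma normc_ge0 z : 0 <= normc z.
Proof. by case: z => a b; exact: sqrtr_ge0. Qed.

Lemma Re_le_normc z : `|complex.Re z| <= normc z.
Proof.
case: z => a b /=; rewrite -sqrtr_sqr; apply: ler_wsqrtr.
by rewrite lerDl sqr_ge0.
Qed.

Lemma normc_le_ReIm z : normc z <= `|complex.Re z| + `|complex.Im z|.
Proof.
case: z => a b /=.
rewrite -[leRHS]ger0_norm ?addr_ge0// -sqrtr_sqr; apply: ler_wsqrtr.
rewrite sqrrD -!normrX !(ger0_norm (sqr_ge0 _)).
by rewrite lerD2r lerDl mulrn_wge0// mulr_ge0.
Qed.

Lemma Im_le_normc z : `|complex.Im z| <= normc z.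
Proof.
case: z => a b /=; rewrite -sqrtr_sqr; apply: ler_wsqrtr.
by rewrite lerDr sqr_ge0.
Qed.

Lemma normc_real (a : R) : normc a%:C = `|a|.
Proof. by rewrite /= expr0n addr0 sqrtr_sqr. Qed.

Lemma le_normcB z z' : normc (z - z') <= normc z + normc z'.
Proof. by rewrite -(normcN z') le_normcD. Qed.

Lemma normc_distC z z' : normc (z - z') = normc (z' - z).
Proof. by rewrite -opprB normcN. Qed.

Lemma normc0_eq0 z : normc z <= 0 -> z = 0.
Proof.
by move=> z0; apply: eq0_normc; apply/eqP; rewrite eq_le z0 normc_ge0.
Qed.

(** The point [exp (i t)] of the unit circle. *)
Definition cis t : R[i] := cos t +i* sin t.

Lemma cis0 : cis 0 = 1.
Proof. by rewrite /cis cos0 sin0. Qed.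

Lemma cisD s t : cis (s + t) = cis s * cis t.
Proof.
by rewrite /cis cosD sinD; apply/eqP; rewrite eq_complex /= eqxx/= addrC.
Qed.

Lemma normc_cis t : normc (cis t) = 1.
Proof. by rewrite /= cos2Dsin2 sqrtr1. Qed.

(** The mean value theorem on the real and imaginary parts separately gives the
    constant 2 instead of 1. *)
Lemma normc_1Bcis t : 0 <= t -> normc (1 - cis t) <= 2 * t.
Proof.
move=> t0; apply: le_trans (normc_le_ReIm _) _.
rewrite /= [0 - _]add0r normrN mulr_natl mulr2n lerD//.
- have [c _] := @MVT_segment R cos (fun x => - sin x) 0 t t0
    (fun x _ => is_derive_cos x)
    (continuous_subspaceT (@continuous_cos R)).
  rewrite cos0 subr0 distrC => ->; rewrite normrM (ger0_norm t0).
  by rewrite ler_piMl// normrN sin_max.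
- have [c _] := @MVT_segment R sin cos 0 t t0
    (fun x _ => is_derive_sin x)
    (continuous_subspaceT (@continuous_sin R)).
  rewrite sin0 !subr0 => ->; rewrite normrM (ger0_norm t0).
  by rewrite ler_piMl// cos_max.
Qed.

End complex_facts.

(** * First passage of a downward-drifting walk *)

Section geometric.
Context {R : realType}.

Lemma le0_geometric (a K k : R) : 0 <= k < 1 ->
  (forall n, a <= K * k ^+ n) -> a <= 0.
Proof.
move=> /andP[k0 k1] aK.
have Kk : geometric K k @ \oo --> (0 : R).
  by apply: cvg_geometric; rewrite ger0_norm.
rewrite -(cvg_lim _ Kk)//; apply: limr_ge; first exact: cvgP Kk.
exact: nearW.
Qed.

End geometric.

Section walk.
Context {R : realType}.
(* If pup < pdown, then pup * x + pdown / x < 1 for x slightly above 1: the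
   function [j |-> x ^+ j] is contracted, with rate k, by the transition
   operator of the walk. *)
Variables (pup pdown x k : R).
Hypotheses (pup0 : 0 <= pup) (pdown0 : 0 <= pdown) (x1 : 1 <= x) (k0 : 0 <= k).
Hypothesis drift : pup * x + pdown / x <= k.

(** A subsolution of the recursion of the walk that starts bounded and decays
    geometrically at 0 decays geometrically everywhere, locally uniformly. *)
Lemma walk_decay (D : nat -> nat -> R[i]) (K : R) : 0 <= K ->
  (forall N, normc (D N 0%N) <= K * k ^+ N) ->
  (forall j, normc (D 0%N j.+1) <= K) ->
  (forall N j, normc (D N.+1 j.+1) <=
     pup * normc (D N j.+2) + pdown * normc (D N j)) ->
  forall N j, normc (D N j) <= K * k ^+ N * x ^+ j.
Proof.
move=> K0 Dz Di Ds.
have x0 : 0 < x by rewrite (lt_le_trans _ x1).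
elim=> [|N IH] [|j]; rewrite ?expr0 ?mulr1; 
  [by have := Dz 0%N; rewrite expr0 mulr1 | | exact: Dz|].
  by rewrite (le_trans (Di j))// ler_peMr// exprn_ege1.
apply: (le_trans (Ds N j)).
have H : pup * normc (D N j.+2) + pdown * normc (D N j) <=
   pup * (K * k ^+ N * x ^+ j.+2) + pdown * (K * k ^+ N * x ^+ j).
  by rewrite lerD// ler_wpM2l.
apply: (le_trans H).
have -> : pup * (K * k ^+ N * x ^+ j.+2) + pdown * (K * k ^+ N * x ^+ j) =
   (K * k ^+ N * x ^+ j.+1) * (pup * x + pdown / x).
  rewrite !exprS; field; exact: lt0r_neq0.
rewrite [k ^+ _.+1]exprSr mulrA -[leRHS]mulrA [k * _]mulrC mulrA.
by rewrite ler_wpM2l// !mulr_ge0// exprn_ge0// ltW.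
Qed.

(** Truncated first-passage functional: the expectation, for the walk started at
    [j], of the product of the factors [c] of the positions visited strictly
    before reaching 0, on the event that 0 is reached in at most [N] steps. *)
Fixpoint hit_gf (c : nat -> R[i]) (N j : nat) {struct N} : R[i] :=
  if j is j'.+1 then
    if N is N'.+1 then
      c j * (pup%:C * hit_gf c N' j.+1 + pdown%:C * hit_gf c N' j')
    else 0
  else 1.

Lemma hit_gf0 c N : hit_gf c N 0 = 1.
Proof. by case: N. Qed.

Lemma hit_gfS c N j : hit_gf c N.+1 j.+1 =
  c j.+1 * (pup%:C * hit_gf c N j.+2 + pdown%:C * hit_gf c N j).
Proof. by []. Qed.

(** Multiplicativity of first passage: to go from [j + 1] to 0 the walk first
    goes down to 1 (seen from level 1 this is the passage from [j] to 0, with the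
    factors [c] shifted by one) and then from 1 to 0, which contributes the limit
    [g]. The difference of the two sides satisfies the recursion of the walk, so
    it vanishes in the limit by [walk_decay]. *)
Lemma hit_gf_shift (c : nat -> R[i]) (g : R[i]) (K : R) : 0 <= K ->
  (forall j, normc (c j) = 1) ->
  (forall N, normc (hit_gf c N 1 - g) <= K * k ^+ N) ->
  forall N j, normc (hit_gf c N j.+1 - hit_gf (c \o succn) N j * g) <=
    K * k ^+ N * x ^+ j.
Proof.
move=> K0 c1 cg; apply: walk_decay => // [N|j|N j].
- by rewrite hit_gf0 mul1r.
- by rewrite /= mul0r subrr normc0.
rewrite !hit_gfS/= -mulrA -mulrBr normcM c1 mul1r.
set a := hit_gf c N j.+3; set b := hit_gf c N j.+1.
set a' := hit_gf _ N j.+2; set b' := hit_gf _ N j.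
have -> : pup%:C * a + pdown%:C * b - (pup%:C * a' + pdown%:C * b') * g =
  pup%:C * (a - a' * g) + pdown%:C * (b - b' * g) by ring.
apply: (le_trans (le_normcD _ _)).
by rewrite !normcM !normc_real !ger0_norm.
Qed.

(** First-step decomposition from 1: [g] and [g'] are the limits of the
    first-passage functionals from 1 for the factors [c] and for the shifted
    factors. *)
Lemma hit_gf_functional (c : nat -> R[i]) (g g' : R[i]) (K : R) : 0 <= K ->
  k < 1 ->
  (forall j, normc (c j) = 1) ->
  (forall N, normc (hit_gf c N 1 - g) <= K * k ^+ N) ->
  (forall N, normc (hit_gf (c \o succn) N 1 - g') <= K * k ^+ N) ->
  g = c 1%N * (pup%:C * (g' * g) + pdown%:C).
Proof.
move=> K0 k1 c1 cg cg'; apply/eqP; rewrite -subr_eq0; apply/eqP.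
apply: normc0_eq0.
apply: (@le0_geometric _ _ (K * k + pup * (K * x + K * normc g)) k).
  by rewrite k0.
move=> N.
set h := hit_gf c N 2; set h' := hit_gf (c \o succn) N 1.
have E : g - c 1%N * (pup%:C * (g' * g) + pdown%:C) =
   (g - hit_gf c N.+1 1) +
   c 1%N * (pup%:C * ((h - h' * g) + (h' - g') * g)).
  by rewrite hit_gfS hit_gf0 -/h; ring.
rewrite E [leRHS]mulrDl; apply: (le_trans (le_normcD _ _)); apply: lerD.
  by rewrite normc_distC (le_trans (cg _))// exprS mulrA.
rewrite !normcM c1 mul1r normc_real ger0_norm// -mulrA ler_wpM2l//.
rewrite [leRHS]mulrDl; apply: (le_trans (le_normcD _ _)); apply: lerD.
  by have := hit_gf_shift K0 c1 cg N 1; rewrite expr1 mulrAC.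
by rewrite normcM [leRHS]mulrAC ler_wpM2r ?normc_ge0//; exact: cg'.
Qed.

End walk.

(** * Characteristic functions restricted to events *)

Section restricted_char_fun.
Context {R : realType} {d : measure_display} {Omega : measurableType d}.
Variable P : probability Omega R.
Implicit Types A B : set Omega.

(** The probability of [A] as a real number. *)
Definition pr A : R := fine (P A).

Lemma pr_ge0 A : 0 <= pr A.
Proof. exact: fine_ge0. Qed.

Lemma EFin_pr A : measurable A -> (pr A)%:E = P A.
Proof. by move=> mA; rewrite fineK// fin_num_measure. Qed.

Lemma prU A B : measurable A -> measurable B -> A `&` B = set0 ->
  pr (A `|` B) = pr A + pr B.
Proof.
by move=> mA mB AB; rewrite /pr measureU// fineD ?fin_num_measure.
Qed.

Lemma prT : pr setT = 1.
Proof. by rewrite /pr probability_setT. Qed.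

Lemma bounded1_integrable A (f : Omega -> R) : measurable A ->
  measurable_fun setT f -> (forall w, `|f w| <= 1) ->
  P.-integrable A (EFin \o f).
Proof.
move=> mA mf f1; apply: measurable_bounded_integrable => //.
- by rewrite (le_lt_trans (probability_le1 _ _))// ltry.
- exact: measurable_funS mf.
- exists 1; split; first exact: num_real.
  by move=> M M1 w _ /=; rewrite (le_trans (f1 w))// ltW.
Qed.

Lemma bounded1_Rintegral A (f : Omega -> R) : measurable A ->
  measurable_fun setT f -> (forall w, `|f w| <= 1) ->
  `|\int[P]_(w in A) f w| <= pr A.
Proof.
move=> mA mf f1; apply: (le_trans (le_normr_Rintegral _ _)) => //.
  exact: bounded1_integrable.
rewrite -[pr A]mul1r /pr -(Rintegral_cst _ mA); apply: le_Rintegral => //.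
- apply: bounded1_integrable => //; first exact: measurableT_comp.
  by move=> w; rewrite normr_id.
- by apply: bounded1_integrable => // w; rewrite normr1.
Qed.

Variables (Z : Omega -> R) (t : R).
Hypothesis mZ : measurable_fun setT Z.

(** [E (exp (i t Z); A)], the characteristic function restricted to [A]. *)
Definition chf_on A : R[i] :=
  (\int[P]_(w in A) cos (t * Z w)) +i* (\int[P]_(w in A) sin (t * Z w)).

Lemma char_funE : char_fun P Z t = chf_on setT.
Proof. by rewrite /char_fun unlock. Qed.

Let mcos : measurable_fun setT (fun w => cos (t * Z w)).
Proof.
apply: measurableT_comp.
  by apply: continuous_measurable_fun => x; exact: continuous_cos.
exact: measurable_funM.
Qed.

Let msin : measurable_fun setT (fun w => sin (t * Z w)).
Proof.
apply: measurableT_comp.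
  by apply: continuous_measurable_fun => x; exact: continuous_sin.
exact: measurable_funM.
Qed.

Lemma normc_chf_on A : measurable A -> normc (chf_on A) <= 2 * pr A.
Proof.
move=> mA; apply: (le_trans (normc_le_ReIm _)); rewrite mulr_natl mulr2n /=.
apply: lerD; apply: bounded1_Rintegral => // w.
- exact: cos_max.
- exact: sin_max.
Qed.

Lemma Re_chf_on A : measurable A -> complex.Re (chf_on A) <= pr A.
Proof.
move=> mA; apply: (le_trans (ler_norm _)); apply: bounded1_Rintegral => // w.
exact: cos_max.
Qed.

Lemma chf_onU A B : measurable A -> measurable B -> A `&` B = set0 ->
  chf_on (A `|` B) = chf_on A + chf_on B.
Proof.
move=> mA mB AB; rewrite /chf_on.
have dAB : [disjoint A & B] by apply/disj_setPS; rewrite AB.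
rewrite !Rintegral_setU//; apply: bounded1_integrable => //.
- exact: measurableU.
- by move=> w; exact: sin_max.
- exact: measurableU.
- by move=> w; exact: cos_max.
Qed.

Lemma chf_on_cst A z : measurable A -> (forall w, A w -> Z w = z) ->
  chf_on A = (pr A)%:C * cis (t * z).
Proof.
move=> mA Az; rewrite /chf_on.
rewrite (@eq_Rintegral _ _ _ P A (fun=> cos (t * z))
  (fun w => cos (t * Z w))); last first.
  by move=> w /set_mem wA /=; rewrite Az.
rewrite (@eq_Rintegral _ _ _ P A (fun=> sin (t * z))
  (fun w => sin (t * Z w))); last first.
  by move=> w /set_mem wA /=; rewrite Az.
rewrite !Rintegral_cst// -/(pr A); apply/eqP; rewrite eq_complex /=.
by rewrite !mul0r subr0 addr0 !(mulrC (pr A)) !eqxx.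
Qed.

End restricted_char_fun.

(** * The return time and the excursion sum *)

Lemma tau0_first (l : nat -> nat) m : (0 < m)%N -> l m = 0%N ->
  (forall i, (0 < i < m)%N -> l i <> 0%N) -> tau0 l = m.
Proof.
move=> m0 lm li; rewrite /tau0; case: pselect => [ex|[]]; last first.
  by exists m; rewrite m0 lm eqxx.
case: ex_minnP => k /andP[k0 /eqP lk] kmin; apply/eqP; rewrite eqn_leq.
rewrite kmin ?m0 ?lm ?eqxx//= leqNgt; apply/negP => km.
by apply: (li k); rewrite ?k0.
Qed.

Lemma tau0_never (l : nat -> nat) :
  (forall i, (0 < i)%N -> l i <> 0%N) -> tau0 l = 0%N.
Proof.
move=> li; rewrite /tau0; case: pselect => // ex; exfalso.
by case: ex => k /andP[k0 /eqP]; exact: li.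
Qed.

(** Each event [tau0 l = m] is a condition on every coordinate of the path
    separately; [m = 0] stands for the paths that never return. *)
Lemma tau0_spec (l : nat -> nat) m :
  tau0 l = m <->
  forall i, ((0 < i)%N && ((m == 0) || (i < m))%N -> l i <> 0%N) /\
            ((0 < m)%N && (i == m) -> l i = 0%N).
Proof.
split=> [<-|h].
- rewrite /tau0; case: pselect => [ex|nex] i.
    case: ex_minnP => k /andP[k0 /eqP lk] kmin; split.
      move=> /andP[i0 /orP[/eqP k00|ik] /eqP li].
        by rewrite k00 in k0.
      by have := kmin i; rewrite i0 li leqNgt ik => /(_ isT).
    by move=> /andP[_ /eqP ->].
  split=> //; rewrite andbT => i0 /eqP li; apply: nex.
  by exists i; rewrite i0.
- have [m0|m0] := posnP m.
    rewrite m0 tau0_never// => i i0; apply: (h i).1.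
    by rewrite i0 m0.
  apply: tau0_first => //; first by apply: (h m).2; rewrite m0 eqxx.
  move=> i /andP[i0 im]; apply: (h i).1.
  by rewrite i0 im orbT.
Qed.

Section measurability.
Context {R : realType} {d : measure_display} {Omega : measurableType d}.
Variables (P : probability Omega R) (L : nat -> {RV P >-> nat}).

Lemma measurable_path (Q : nat -> nat -> Prop) :
  measurable [set w | forall i, Q i (L i w)].
Proof.
rewrite (_ : [set w | _] = \bigcap_i (L i @^-1` [set n | Q i n])).
  by apply: bigcapT_measurable => i; exact: measurable_funPTI.
by apply/seteqP; split=> w /= h i => [_|]; exact: h.
Qed.

Lemma measurable_excursion_sum (Lambda : R) :
  measurable_fun setT (fun w => excursion_sum Lambda (fun j => L j w)).
Proof.
move=> _ Y mY; rewrite setTI.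
rewrite (_ : _ @^-1` _ = \bigcup_m
   ([set w | tau0 (fun j => L j w) = m] `&`
    (fun w => \sum_(0 <= j < m) Lambda ^+ (2 * L j w)) @^-1` Y)).
  apply: bigcupT_measurable => m; apply: measurableI.
    have := measurable_path (fun i n =>
      ((0 < i)%N && ((m == 0) || (i < m))%N -> n <> 0%N) /\
      ((0 < m)%N && (i == m) -> n = 0%N)).
    by congr measurable; apply/seteqP; split=> w /tau0_spec.
  rewrite -[X in measurable X]setTI.
  apply: measurable_sum => // j.
  exact: (@measurableT_comp _ _ _ _ _ _ (fun n : nat => Lambda ^+ (2 * n)) _
    (L j : Omega -> nat)).
apply/seteqP; split=> [w Yw|w [m _ [/= <-]]]//.
by exists (tau0 (fun j => L j w)).
Qed.

End measurability.

(** * The excursion chain *)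

Section chain.
Context {R : realType} {d : measure_display} {Omega : measurableType d}.
Variables (P : probability Omega R) (L : nat -> {RV P >-> nat}).
Variables (pup pdown : R).
Hypotheses (pup0 : 0 < pup) (pdown0 : 0 < pdown) (p1 : pup + pdown = 1).
Hypothesis LM : is_markov_chain 0 (transition pup pdown) L.

(** The chain follows the path [x] up to time [n]. *)
Definition hist (n : nat) (x : nat -> nat) : set Omega :=
  [set w | forall i, (i <= n)%N -> L i w = x i].

Lemma measurable_hist n x : measurable (hist n x).
Proof. exact: (measurable_path L (fun i k => (i <= n)%N -> k = x i)). Qed.

(** The path [x] up to time [m], followed by the state [y]. *)
Definition extend (x : nat -> nat) (m y : nat) (i : nat) : nat :=
  if (i <= m)%N then x i else y.

Lemma hist_extend m x y :
  hist m.+1 (extend x m y) = [set w | L m.+1 w = y] `&` hist m x.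
Proof.
apply/seteqP; split=> w /=.
- move=> h; split; first by have := h m.+1 (leqnn _); rewrite /extend ltnn.
  by move=> i im; rewrite (h i (leqW im)) /extend im.
- move=> [Ly h] i; rewrite leq_eqVlt /extend => /orP[/eqP ->|].
    by rewrite ltnn.
  by rewrite ltnS => im; rewrite im; exact: h.
Qed.

Lemma pr_hist_extend m x y :
  pr P (hist m.+1 (extend x m y)) =
  transition pup pdown (x m) y * pr P (hist m x).
Proof.
have [P0|P0] := eqVneq (P (hist m x)) 0%E.
  rewrite /pr P0 mulr0; apply/eqP; rewrite fine_eq0; last first.
    by rewrite fin_num_measure//; exact: measurable_hist.
  rewrite eq_le measure_ge0 andbT -P0.
  apply: le_measure; rewrite ?inE; try exact: measurable_hist.
  by rewrite hist_extend; exact: subIsetr.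
have := LM.2 m x y P0; rewrite /cond_prob -/(hist m x) -hist_extend => <-.
rewrite /pr divfK// fine_eq0// fin_num_measure//; exact: measurable_hist.
Qed.

(** Off 0, a history is almost surely continued by a step up or a step down. *)
Lemma hist_split m x : x m <> 0%N ->
  exists N, [/\ measurable N, pr P N = 0,
   hist m x = (hist m.+1 (extend x m (x m).+1) `|`
               hist m.+1 (extend x m (x m).-1)) `|` N,
   hist m.+1 (extend x m (x m).+1) `&` hist m.+1 (extend x m (x m).-1) = set0 &
   (hist m.+1 (extend x m (x m).+1) `|`
               hist m.+1 (extend x m (x m).-1)) `&` N = set0].
Proof.
move=> xm.
set U := hist m.+1 (extend x m (x m).+1).
set D := hist m.+1 (extend x m (x m).-1).
have mU : measurable U by exact: measurable_hist.
have mD : measurable D by exact: measurable_hist.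
have mH : measurable (hist m x) by exact: measurable_hist.
have UD0 : U `&` D = set0.
  apply/seteqP; split=> w //; rewrite /U /D !hist_extend.
  move=> -[[/= -> _] [/= e _]].
  by move: e; lia.
have UDH : U `|` D `<=` hist m x.
  by rewrite /U /D !hist_extend => w [[]|[]].
have mN : measurable (hist m x `\` (U `|` D)).
  by apply: measurableD => //; exact: measurableU.
have dis : (U `|` D) `&` (hist m x `\` (U `|` D)) = set0 by rewrite setDIK.
have E : hist m x = (U `|` D) `|` (hist m x `\` (U `|` D)).
  by rewrite setDUK.
exists (hist m x `\` (U `|` D)); split => //.
have := prU P (measurableU _ _ mU mD) mN dis.
rewrite -E prU// /U /D !pr_hist_extend /transition.
have -> : (x m == 0%N) = false by apply/eqP.
rewrite eqxx.
have -> : ((x m).-1 == (x m).+1) = false by apply/eqP; lia.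
rewrite eqxx -mulrDl p1 mul1r.
by move=> /eqP; rewrite -subr_eq0 opprD addrA subrr add0r oppr_eq0 => /eqP.
Qed.

Variables (Lambda t : R).

Let Z w := excursion_sum Lambda (fun j => L j w).
Let mZ : measurable_fun setT Z := measurable_excursion_sum L Lambda.

(** The factor contributed to [exp (i t Z)] by one visit of the state [j]. *)
Definition level_phase j : R[i] := cis (t * Lambda ^+ (2 * j)).

(** Conditionally on a history [x] that has not returned to 0 before time [m],
    [exp (i t Z)] averages to the phase accumulated so far times the first-passage
    functional of the current state. The error bound dominates the probability of
    not returning in [N] more steps, so the paths that never return, on which [Z]
    is not the sum over the path, need no separate treatment. *)
Lemma chf_on_hist (b k : R) : 1 <= b -> 0 <= k -> pup * b + pdown / b <= k ->
  forall N m x, (0 < m)%N -> (forall i, (0 < i < m)%N -> x i <> 0%N) ->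
  normc (chf_on P Z t (hist m x) -
    (pr P (hist m x))%:C * cis (t * \sum_(0 <= j < m) Lambda ^+ (2 * x j)) *
     hit_gf pup pdown level_phase N (x m)) <=
  2 * pr P (hist m x) * (k ^+ N * b ^+ x m).
Proof.
move=> b1 k0 drift.
have b0 : 0 < b by rewrite (lt_le_trans _ b1).
have zero_case N m x : (0 < m)%N -> (forall i, (0 < i < m)%N -> x i <> 0%N) ->
  x m = 0%N ->
  normc (chf_on P Z t (hist m x) -
    (pr P (hist m x))%:C * cis (t * \sum_(0 <= j < m) Lambda ^+ (2 * x j)) *
     hit_gf pup pdown level_phase N (x m)) <=
  2 * pr P (hist m x) * (k ^+ N * b ^+ x m).
  move=> m0 xi xm0.
  (* x m = 0: the excursion is over and Z is constant on the event. *)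
  rewrite xm0 hit_gf0 mulr1.
  rewrite (@chf_on_cst _ _ _ _ _ _ _ (\sum_(0 <= j < m) Lambda ^+ (2 * x j))).
  - by rewrite subrr normc0 !mulr_ge0 ?pr_ge0 ?exprn_ge0// ltW.
  - exact: measurable_hist.
  - move=> w h; rewrite /Z /excursion_sum (@tau0_first _ m)//.
    + by apply: eq_big_nat => j /andP[_ jm]; rewrite h// ltnW.
    + by rewrite h.
    + by move=> i /[dup] /andP[i0 im] /xi; rewrite h// ltnW.
elim=> [|N IH] m x m0 xi; have [xm0|xm0] := eqVneq (x m) 0%N;
  try exact: zero_case.
  (* No steps left: the functional vanishes off 0. *)
  case E : (x m) xm0 => [|j]// _.
  rewrite [hit_gf _ _ _ _ _]/= mulr0 subr0 expr0 mul1r.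
  apply: (le_trans (normc_chf_on P t mZ (measurable_hist _ _))).
  by rewrite ler_peMr ?exprn_ege1// mulr_ge0// pr_ge0.
(* One step of the chain: apply the induction hypothesis to both continuations. *)
have xm1 : x m <> 0%N by apply/eqP.
have [N0 [mN prN E UD0 dis]] := hist_split xm1.
have prU' := pr_hist_extend m x (x m).+1.
have prD' := pr_hist_extend m x (x m).-1.
set U := hist m.+1 (extend x m (x m).+1) in E UD0 dis prU'.
set D := hist m.+1 (extend x m (x m).-1) in E UD0 dis prD'.
have mU : measurable U by exact: measurable_hist.
have mD : measurable D by exact: measurable_hist.
have chfN : chf_on P Z t N0 = 0.
  apply: normc0_eq0; apply: (le_trans (normc_chf_on P t mZ mN)).
  by rewrite prN mulr0.
have -> : chf_on P Z t (hist m x) = chf_on P Z t U + chf_on P Z t D.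
  by rewrite E !chf_onU// ?chfN ?addr0//; exact: measurableU.
have sum_ext y : \sum_(0 <= j < m.+1) Lambda ^+ (2 * extend x m y j) =
    \sum_(0 <= j < m) Lambda ^+ (2 * x j) + Lambda ^+ (2 * x m).
  rewrite big_nat_recr//= /extend leqnn; congr (_ + _).
  by apply: eq_big_nat => j /andP[_ jm]; rewrite ltnW.
have ext_pos y i : (0 < i < m.+1)%N -> extend x m y i <> 0%N.
  move=> /andP[i0]; rewrite ltnS /extend => im; rewrite im.
  have [->//|nim] := eqVneq i m.
  by apply: xi; rewrite i0 ltn_neqAle nim.
have ext_last y : extend x m y m.+1 = y by rewrite /extend ltnn.
have := IH m.+1 (extend x m (x m).+1) isT (ext_pos _).
have := IH m.+1 (extend x m (x m).-1) isT (ext_pos _).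
rewrite -/U -/D prU' prD' !sum_ext !ext_last.
case Ej : (x m) xm1 => [|j]// _.
rewrite /transition /= eqxx.
have -> : (j == j.+2) = false by apply/eqP; lia.
rewrite eqxx mulrDr cisD -/(level_phase j.+1).
set S := cis _; set h := pr P _.
set GU := hit_gf _ _ _ N j.+2; set GD := hit_gf _ _ _ N j.
move=> HD HU.
have -> : chf_on P Z t U + chf_on P Z t D -
    h%:C * S * (level_phase j.+1 * (pup%:C * GU + pdown%:C * GD)) =
  (chf_on P Z t U - (pup * h)%:C * (S * level_phase j.+1) * GU) +
  (chf_on P Z t D - (pdown * h)%:C * (S * level_phase j.+1) * GD).
  by rewrite !rmorphM/=; ring.
apply: (le_trans (le_normcD _ _)); apply: (le_trans (lerD HU HD)).
rewrite (_ : _ + _ = 2 * h * (k ^+ N * b ^+ j.+1) * (pup * b + pdown / b)).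
  rewrite [k ^+ _.+1]exprS [leRHS](_ : _ = 2 * h * (k ^+ N * b ^+ j.+1) * k);
    last by ring.
  by rewrite ler_wpM2l// !mulr_ge0 ?pr_ge0 ?exprn_ge0// ltW.
rewrite !exprS; field; exact: lt0r_neq0.
Qed.

Lemma char_fun_approx (b k : R) : 1 <= b -> 0 <= k ->
  pup * b + pdown / b <= k ->
  forall N, normc (char_fun P Z t -
    cis t * hit_gf pup pdown level_phase N 1) <= 2 * b * k ^+ N.
Proof.
move=> b1 k0 drift N.
set x := extend (fun=> 0%N) 0 1.
have prH : pr P (hist 1 x) = 1.
  rewrite pr_hist_extend /transition/= mul1r.
  rewrite /pr (_ : hist 0 _ = [set w | L 0%N w = 0%N]) ?LM.1//.
  apply/seteqP; split=> w /=; first exact.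
  by move=> Lw i; rewrite leqn0 => /eqP ->.
have mH : measurable (hist 1 x) by exact: measurable_hist.
have prC : pr P (~` hist 1 x) = 0.
  rewrite /pr probability_setC// -EFin_pr// prH subee//.
have chfT : chf_on P Z t setT = chf_on P Z t (hist 1 x).
  rewrite -(setUv (hist 1 x)) chf_onU//.
  - rewrite (normc0_eq0 (z := chf_on _ _ _ (~` _))) ?addr0//.
    rewrite (le_trans (normc_chf_on P t mZ _)) ?prC ?mulr0//.
    exact: measurableC.
  - exact: measurableC.
  - exact: setICr.
rewrite char_funE chfT.
have := @chf_on_hist b k b1 k0 drift N 1 x isT.
rewrite prH big_nat1 mul1r muln0 expr0 !mulr1 expr1 [k ^+ N * b]mulrC mulrA.
apply.
by move=> [|[]].
Qed.

End chain.

(** * The scaling equation of the characteristic function *)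

Section char_fun_equation.
Context {R : realType} {d : measure_display} {Omega : measurableType d}.
Variables (P : probability Omega R) (L : nat -> {RV P >-> nat}).
Variables (pup pdown b k Lambda : R).
Hypotheses (pup0 : 0 < pup) (pdown0 : 0 < pdown) (p1 : pup + pdown = 1).
Hypothesis LM : is_markov_chain 0 (transition pup pdown) L.
Hypotheses (b1 : 1 <= b) (k01 : 0 <= k < 1) (drift : pup * b + pdown / b <= k).

Let phi := char_fun P (fun w => excursion_sum Lambda (fun j => L j w)).

(** Scaling equation: the stretches of an excursion above level 1 are, after
    division of their weights by [Lambda ^+ 2], copies of the excursion itself. *)
Lemma char_fun_functional t :
  phi t * (1 - pup%:C * phi (Lambda ^+ 2 * t)) =
  pdown%:C * cis ((1 + Lambda ^+ 2) * t).
Proof.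
have /andP[k0 k1] := k01.
(* The level 0 is visited once in an excursion; g describes the passage from 1. *)
pose g s := cis (- s) * phi s.
have phig s : phi s = cis s * g s.
  by rewrite /g mulrA -cisD subrr cis0 mul1r.
have approx s N :
    normc (hit_gf pup pdown (level_phase Lambda s) N 1 - g s) <= 2 * b * k ^+ N.
  have := char_fun_approx pup0 pdown0 p1 LM Lambda s b1 k0 drift N.
  rewrite -/phi phig -mulrBr normcM normc_cis mul1r.
  by rewrite normc_distC.
have shift : level_phase Lambda (Lambda ^+ 2 * t) =
    level_phase Lambda t \o succn.
  apply/funext => j; rewrite /level_phase /=; congr cis.
  by rewrite mulnS exprD; ring.
have := @hit_gf_functional _ pup pdown b k (ltW pup0) (ltW pdown0) b1 k0 drift
  (level_phase Lambda t) (g t) (g (Lambda ^+ 2 * t)) (2 * b) _ k1 _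
  (approx t) _.
rewrite -shift => /(_ _ _ _) E.
have {}E : g t = level_phase Lambda t 1 *
    (pup%:C * (g (Lambda ^+ 2 * t) * g t) + pdown%:C).
  apply: E => //; first by rewrite mulr_ge0// (le_trans ler01).
  - by move=> j; exact: normc_cis.
have c1 : level_phase Lambda t 1 = cis (Lambda ^+ 2 * t).
  by rewrite /level_phase muln1 mulrC.
rewrite c1 in E.
rewrite !phig mulrDl mul1r cisD.
set x := cis t; set y := cis _ in E *; set g' := g (_ * _) in E *.
have : g t * (1 - pup%:C * (y * g')) = pdown%:C * y.
  by rewrite mulrBr mulr1 {1}E; ring.
by move=> h; rewrite -mulrA h; ring.
Qed.

Lemma Re_char_fun_le1 t : complex.Re (phi t) <= 1.
Proof.
rewrite /phi char_funE -(prT P); apply: Re_chf_on => //.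
exact: measurable_excursion_sum.
Qed.

Lemma normc_char_fun t : normc (phi t) <= 2.
Proof.
rewrite /phi char_funE.
have := normc_chf_on P t (measurable_excursion_sum L Lambda) measurableT.
by rewrite prT mulr1.
Qed.

End char_fun_equation.

(** * Limits of sequences with geometric increments *)

Section limits.
Context {R : realType}.

Lemma cvg_geometric_increments (a : nat -> R) (C q : R) :
  0 <= C -> 0 < q < 1 ->
  (forall n, `|a n.+1 - a n| <= C * q ^+ n.+1) ->
  cvgn a /\ `|limn a - a 0%N| <= C * q / (1 - q).
Proof.
move=> C0 /andP[q0 q1] aC.
have q1' : 0 < 1 - q by rewrite subr_gt0.
(* T n bounds the sum of the increments from n on. *)
pose T n := C * q ^+ n.+1 / (1 - q).
have T0 n : 0 <= T n.
  by rewrite /T divr_ge0 ?mulr_ge0 ?exprn_ge0 ?(ltW q0) ?(ltW q1').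
have TS n : T n = T n.+1 + C * q ^+ n.+1.
  by rewrite /T [q ^+ n.+2]exprS; field; rewrite gt_eqF.
have bnd n : `|a n - a 0%N| <= T 0%N - T n.
  elim: n => [|n IH]; first by rewrite !subrr normr0.
  have -> : a n.+1 - a 0%N = (a n.+1 - a n) + (a n - a 0%N) by ring.
  apply: (le_trans (ler_normD _ _)); apply: (le_trans (lerD (aC n) IH)).
  by rewrite (TS n); lra.
have bnd0 n : a 0%N - T 0%N <= a n <= a 0%N + T 0%N.
  by have := bnd n; have := T0 n; rewrite ler_norml; lra.
have Tcvg : T @ \oo --> (0 : R).
  have -> : T = geometric (C * q / (1 - q)) q.
    by apply/funext => n; rewrite /T/= exprS; field; rewrite gt_eqF.
  by apply: cvg_geometric; rewrite ger0_norm// ltW.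
(* Adding T makes the sequence nonincreasing. *)
have bcvg : cvgn (fun n => a n + T n).
  apply: nonincreasing_is_cvgn.
    apply/nonincreasing_seqP => n; have := aC n; rewrite (TS n) ler_norml.
    by rewrite /=; lra.
  exists (a 0%N - T 0%N) => _ [n _ <-].
  by have := bnd0 n; have := T0 n; lra.
have acvg : cvgn a.
  rewrite (_ : a = (fun n => a n + T n) \- T).
    by apply: is_cvgB => //; exact: cvgP Tcvg.
  by apply/funext => n /=; rewrite addrK.
split => //.
rewrite ler_distl; apply/andP; split.
  by apply: limr_ge => //; apply: nearW => n; have := bnd0 n;
    rewrite /T expr1; lra.
by apply: limr_le => //; apply: nearW => n; have := bnd0 n;
  rewrite /T expr1; lra.
Qed.

Lemma cvg_complex (w : nat -> R[i]^o) (x y : R) :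
  (fun n => complex.Re (w n)) @ \oo --> x ->
  (fun n => complex.Im (w n)) @ \oo --> y ->
  w @ \oo --> (x +i* y : R[i]^o).
Proof.
move=> wx wy; apply/cvgrPdist_lt => e e0.
have [eI eR] : complex.Im e = 0 /\ 0 < complex.Re e.
  by move: e0; rewrite ltcE /= => /andP[/eqP -> ->].
have e20 : 0 < complex.Re e / 2 by rewrite divr_gt0.
move/cvgrPdist_lt : wx => /(_ _ e20) wx.
move/cvgrPdist_lt : wy => /(_ _ e20) wy.
near=> n.
have hx : `|x - complex.Re (w n)| < complex.Re e / 2 by near: n.
have hy : `|y - complex.Im (w n)| < complex.Re e / 2 by near: n.
rewrite -[e]RRe_real; last by rewrite realE (ltW e0).
rewrite [`|_|]normc_def ltcR.
have := normc_le_ReIm ((x +i* y) - w n).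
case: (w n) hx hy => u v /= hx hy h.
by apply: (le_lt_trans h); lra.
Unshelve. all: by end_near.
Qed.

End limits.

(** * The renormalized recursion *)

Section recursion.
Context {R : realType}.

Lemma Re_ge0_normc (a : R) (u : R[i]) : 0 <= a -> 0 <= complex.Re u ->
  1 <= normc (1 + a%:C * u).
Proof.
move=> a0 u0; apply: le_trans (Re_le_normc _).
case: u u0 => x y /= x0; rewrite mul0r subr0.
by rewrite (le_trans _ (ler_norm _))// lerDl mulr_ge0.
Qed.

(** With [v n = u n / q ^+ n] the recursion reads
    [v (n + 1) (1 + q u n) = v n + e n / q ^+ (n + 1)], and the denominators
    [1 + q u n] have modulus at least 1 because [0 <= Re (u n)]. So [v] stays
    bounded by 4, its increments are at most [32 q ^+ (n + 1)], and its limit is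
    close to [v 0 = u 0] when [q] is small. *)
Lemma recursion_limit (q : R) (u e : nat -> R[i]) : 0 < q <= 1 / 101 ->
  (forall n, u n.+1 * (1 + q%:C * u n) = q%:C * u n + e n) ->
  (forall n, 0 <= complex.Re (u n)) ->
  normc (u 0%N) <= 3 ->
  (forall n, normc (e n) <= 16 * q ^+ (2 * n.+1)) ->
  let v n := (q ^- n)%:C * u n in
  [/\ cvgn (fun n => complex.Re (v n)),
      cvgn (fun n => complex.Im (v n)) &
      `|limn (fun n => complex.Re (v n)) - complex.Re (u 0%N)| <= 1 / 3].
Proof.
move=> /andP[q0 q101] rec uRe u0 eq16 v.
have qn0 : q != 0 by rewrite gt_eqF.
have q1 : q < 1 by lra.
have qX n : 0 <= q ^+ n by rewrite exprn_ge0// ltW.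
have vS n : v n.+1 * (1 + q%:C * u n) = v n + (q ^- n.+1)%:C * e n.
  rewrite /v -mulrA rec mulrDr mulrA -rmorphM/=; congr (_%:C * _ + _).
  by rewrite exprS; field; rewrite expf_neq0.
have ve n : normc ((q ^- n.+1)%:C * e n) <= 16 * q ^+ n.+1.
  rewrite normcM normc_real ger0_norm ?invr_ge0//.
  rewrite ler_pdivrMl ?exprn_gt0// (le_trans (eq16 n))//.
  by rewrite mul2n -addnn exprD mulrCA.
have den n := Re_ge0_normc (ltW q0) (uRe n).
have vb n : normc (v n) <= 4 - q ^+ n.
  elim: n => [|n IH].
    by rewrite /v expr0 invr1 mul1r; lra.
  have : normc (v n.+1) <= normc (v n.+1 * (1 + q%:C * u n)).
    by rewrite [leRHS]normcM ler_peMr// normc_ge0.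
  rewrite vS => h; apply: (le_trans h); apply: (le_trans (le_normcD _ _)).
  have := ve n; have : 0 < q ^+ n by rewrite exprn_gt0.
  rewrite exprS; nra.
have v4 n : normc (v n) <= 4.
  by apply: (le_trans (vb n)); rewrite gerBl exprn_ge0// ltW.
have uv n : u n = (q ^+ n)%:C * v n.
  by rewrite /v mulrA -rmorphM/= divff ?mul1r// expf_neq0.
have dv n : normc (v n.+1 - v n) <= 32 * q ^+ n.+1.
  have : normc (v n.+1 - v n) <= normc ((v n.+1 - v n) * (1 + q%:C * u n)).
    by rewrite [leRHS]normcM ler_peMr// normc_ge0.
  rewrite mulrBl vS => h; apply: (le_trans h).
  rewrite (_ : _ - _ = (q ^- n.+1)%:C * e n - (q ^+ n.+1)%:C * (v n * v n)).
    apply: (le_trans (le_normcB _ _)).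
    rewrite (_ : 32 * _ = 16 * q ^+ n.+1 + q ^+ n.+1 * (4 * 4)); last by ring.
    apply: lerD => //; rewrite normcM normc_real ger0_norm//.
    by rewrite ler_wpM2l// normcM ler_pM ?normc_ge0.
  by rewrite [in X in _ - v n * X]uv exprS rmorphM/=; ring.
have q01 : 0 < q < 1 by rewrite q0.
have [| |Rcvg Rlim] :=
  @cvg_geometric_increments _ (fun n => complex.Re (v n)) 32 q _ q01.
- by [].
- move=> n; apply: le_trans (dv n); apply: le_trans (Re_le_normc _).
  by case: (v n.+1) (v n) => ? ? [].
have [| |Icvg _] :=
  @cvg_geometric_increments _ (fun n => complex.Im (v n)) 32 q _ q01.
- by [].
- move=> n; apply: le_trans (dv n); apply: le_trans (Im_le_normc _).
  by case: (v n.+1) (v n) => ? ? [].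
split=> //.
rewrite (_ : complex.Re (u 0%N) = complex.Re (v 0%N)).
  apply: (le_trans Rlim); rewrite ler_pdivrMr; lra.
by rewrite /v expr0 invr1 mul1r.
Qed.

End recursion.

(** * The limit at Lambda = 101 and alpha = 1 *)

Section asymptotics.
Context {R : realType} {d : measure_display} {Omega : measurableType d}.
Variables (P : probability Omega R) (L : nat -> {RV P >-> nat}).
Variables (pup pdown : R).
Hypotheses (pup0 : 0 < pup) (pdown0 : 0 < pdown) (p1 : pup + pdown = 1).
Hypothesis ratio : pdown / pup = 101.
Hypothesis LM : is_markov_chain 0 (transition pup pdown) L.

Let phi := char_fun P (fun w => excursion_sum (101 : R) (fun j => L j w)).
(* q = pup / pdown = Lambda ^- alpha *)
Let q : R := 101^-1.
Let u t : R[i] := 1 - phi t.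

Lemma char_fun_recursion t :
  u t * (1 + q%:C * u (101 ^+ 2 * t)) =
  q%:C * u (101 ^+ 2 * t) + (1 - cis ((1 + 101 ^+ 2) * t)).
Proof.
have pdE : pdown = 101 * pup.
  by rewrite -ratio divfK// gt_eqF.
have pupE : pup = 1 / 102 by move: p1; rewrite pdE; lra.
have k01 : 0 <= (3 / 5 : R) < 1 by apply/andP; split; lra.
have drift : pup * 2 + pdown / 2 <= 3 / 5 by rewrite pdE pupE; lra.
have b1 : 1 <= (2 : R) by lra.
have := char_fun_functional 101 pup0 pdown0 p1 LM b1 k01 drift t.
rewrite -/phi /u.
set f := phi t; set f' := phi _; set c := cis _ => E.
have pdq : pup%:C = pdown%:C * q%:C.
  by rewrite -rmorphM/= pdE /q; congr (_%:C); field.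
have pd1 : 1 = pup%:C + pdown%:C :> R[i] by rewrite -rmorphD/= p1.
have pdN0 : pdown%:C != 0 :> R[i].
  by apply/eqP => -[] /eqP; rewrite gt_eqF.
have : f * (1 + q%:C * (1 - f')) = c.
  apply: (mulfI pdN0); rewrite -E.
  rewrite (_ : 1 - pup%:C * f' = (pup%:C + pdown%:C) - pup%:C * f');
    last by rewrite -pd1.
  rewrite pdq; ring.
by move=> <-; ring.
Qed.

Lemma normc_u t : normc (u t) <= 3.
Proof.
apply: (le_trans (le_normcB _ _)); rewrite normc1.
by have := normc_char_fun L 101 t; rewrite -/phi; lra.
Qed.

Lemma Re_u_ge0 t : 0 <= complex.Re (u t).
Proof.
have := Re_char_fun_le1 L 101 t; rewrite -/phi /u.
by case: (phi t) => x y /=; rewrite subr_ge0.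
Qed.

(** Up to a small error, [c_theta * sqrt theta] is [1 - exp (i s)], where
    [s = theta (1 + Lambda ^+ 2)] is the phase of the shortest excursion. *)
Lemma c_theta_approx (s : R) : 0 < s <= 8 ->
  let theta := s / (1 + 101 ^+ 2) in
  cvgn (c_seq 101 1 phi theta) /\
  `|complex.Re (c_theta 101 1 phi theta) * Num.sqrt theta - (1 - cos s)| <=
    2 / 5.
Proof.
move=> /andP[s0 s8] theta.
have D0 : 0 < (1 + 101 ^+ 2 : R) by rewrite addr_gt0// exprn_gt0.
have theta0 : 0 < theta by rewrite divr_gt0.
have q0 : 0 < q by rewrite invr_gt0.
have q101 : 0 < q <= 1 / 101 by rewrite q0 div1r /=.
have qE n : theta / 101 ^+ (2 * n) = theta * q ^+ (2 * n) by rewrite exprVn.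
pose un n := u (theta * q ^+ (2 * n)).
pose e n : R[i] := 1 - cis (s * q ^+ (2 * n.+1)).
have qc : (101 ^+ 2 * q ^+ 2 : R) = 1 by rewrite -exprMn /q divff ?expr1n.
have step n : un n = u (101 ^+ 2 * (theta * q ^+ (2 * n.+1))).
  rewrite /un mulnS exprD; congr u.
  rewrite (_ : 101 ^+ 2 * _ = theta * (101 ^+ 2 * q ^+ 2) * q ^+ (2 * n)).
    by rewrite qc mulr1.
  ring.
have rec n : un n.+1 * (1 + q%:C * un n) = q%:C * un n + e n.
  rewrite (step n) [un n.+1]/un char_fun_recursion /e; congr (_ + (1 - cis _)).
  by rewrite mulrA /theta mulrCA divff ?mulr1// gt_eqF.
have e16 n : normc (e n) <= 16 * q ^+ (2 * n.+1).
  have qn : 0 <= q ^+ (2 * n.+1) by rewrite exprn_ge0// ltW.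
  apply: (le_trans (normc_1Bcis _)); first by rewrite mulr_ge0// ltW.
  by rewrite mulrA ler_wpM2r//; lra.
have [Rcvg Icvg Rlim] := recursion_limit q101 rec (fun n => Re_u_ge0 _)
  (normc_u _) e16.
(* The excursions longer than 0, 1, 0 contribute at most 3 q to u 0. *)
have first_step : `|complex.Re (un 0%N) - (1 - cos s)| <= 3 * q.
  pose u' := u (101 ^+ 2 * theta).
  have := char_fun_recursion theta; rewrite -/u'.
  rewrite (_ : (1 + _) * theta = s); last first.
    by rewrite /theta mulrCA divff ?mulr1// gt_eqF.
  rewrite /un muln0 expr0 mulr1 => E.
  have den := Re_ge0_normc (ltW q0) (Re_u_ge0 (101 ^+ 2 * theta)).
  have : normc (u theta - (1 - cis s)) <= 3 * q.
    apply: (@le_trans _ _ (normc ((u theta - (1 - cis s)) * (1 + q%:C * u')))).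
      by rewrite [leRHS]normcM ler_peMr// normc_ge0.
    rewrite (_ : _ * _ = q%:C * u' * cis s).
      rewrite !normcM normc_cis mulr1 normc_real ger0_norm ?(ltW q0)//.
      by rewrite mulrC ler_wpM2r ?normc_u// ltW.
    by rewrite mulrBl E; ring.
  apply: le_trans; apply: le_trans (Re_le_normc _).
  by rewrite /cis; case: (u theta) => x y /=.
have sth : 0 < Num.sqrt theta by rewrite sqrtr_gt0.
have cE n : c_seq 101 1 phi theta n =
    ((q ^- n)%:C * un n) * ((Num.sqrt theta)^-1)%:C.
  rewrite /c_seq qE -/(u _) -/(un n) ger0_norm; last first.
    by rewrite mulr_ge0 ?exprn_ge0 ?ltW.
  rewrite div1r powR12_sqrt; last by rewrite mulr_ge0 ?exprn_ge0 ?ltW.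
  rewrite (sqrtrM _ (ltW theta0)) mulnC exprM sqrtr_sqr.
  rewrite (ger0_norm (exprn_ge0 _ (ltW q0))).
  by rewrite -fmorphV/= invfM [(Num.sqrt _)^-1 * _]mulrC rmorphM/=; ring.
have Re_c : (fun n => complex.Re (c_seq 101 1 phi theta n)) =
    (fun n => complex.Re ((q ^- n)%:C * un n) * (Num.sqrt theta)^-1).
  apply/funext => n; rewrite cE; case: (_ * un n) => x y /=.
  by rewrite mulr0 subr0.
have Im_c : (fun n => complex.Im (c_seq 101 1 phi theta n)) =
    (fun n => complex.Im ((q ^- n)%:C * un n) * (Num.sqrt theta)^-1).
  apply/funext => n; rewrite cE; case: (_ * un n) => x y /=.
  by rewrite mulr0 add0r.
have cvg_c := cvg_complex (w := c_seq 101 1 phi theta).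
have Rc : (fun n => complex.Re (c_seq 101 1 phi theta n)) @ \oo -->
    limn (fun n => complex.Re ((q ^- n)%:C * un n)) * (Num.sqrt theta)^-1.
  by rewrite Re_c; exact: cvgMl.
have Ic : (fun n => complex.Im (c_seq 101 1 phi theta n)) @ \oo -->
    limn (fun n => complex.Im ((q ^- n)%:C * un n)) * (Num.sqrt theta)^-1.
  by rewrite Im_c; exact: cvgMl.
have {}cvg_c := cvg_c _ _ Rc Ic.
split; first exact: cvgP cvg_c.
rewrite /c_theta (cvg_lim _ cvg_c)//=.
rewrite divfK ?gt_eqF//.
set l := limn _ in Rlim *.
rewrite (_ : l - _ = (l - complex.Re (un 0%N)) +
                     (complex.Re (un 0%N) - (1 - cos s)));
  last by ring.
apply: (le_trans (ler_normD _ _)); apply: (le_trans (lerD Rlim first_step)).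
by rewrite /q; lra.
Qed.

End asymptotics.

Theorem proposition5p2 (R : realType) :
  exists Lambda alpha theta1 theta2 : R,
    [/\ 1 < Lambda, 0 < alpha < 2, 0 < theta1, 0 < theta2 &
      forall (pup pdown : R),
        0 < pup -> 0 < pdown -> pup + pdown = 1 ->
        pdown / pup = Lambda `^ alpha ->
      forall (d : measure_display) (Omega : measurableType d)
        (P : probability Omega R) (L : nat -> {RV P >-> nat}),
        is_markov_chain 0 (transition pup pdown) L ->
      let Z : Omega -> R :=
        fun w => excursion_sum Lambda (fun j => L j w) in
      let phi := char_fun P Z in
      [/\ cvgn (c_seq Lambda alpha phi theta1),
          cvgn (c_seq Lambda alpha phi theta2) &
          c_theta Lambda alpha phi theta1 <> c_theta Lambda alpha phi theta2]].
Proof.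
have pi4 : (pi : R) <= 4.
  by have [/andP[_ h] _] := pihalf_02_cos_pihalf R; move: h; lra.
have pi0 := pi_gt0 R.
have D0 : 0 < (1 + 101 ^+ 2 : R) by rewrite addr_gt0// exprn_gt0.
(* The values s = pi and s = 2 pi of theta (1 + Lambda ^+ 2). *)
exists 101, 1, (pi / (1 + 101 ^+ 2)), (2 * pi / (1 + 101 ^+ 2)).
split; [by lra | by apply/andP; split; lra | by rewrite divr_gt0
  | by rewrite divr_gt0// mulr_gt0 |].
move=> pup pdown pup0 pdown0 p1; rewrite powRr1; last by lra.
move=> ratio d Omega P L LM Z phi.
have [|cvg1 lim1] := c_theta_approx pup0 pdown0 p1 ratio LM (s := pi).
  by apply/andP; split; lra.
have [|cvg2 lim2] := c_theta_approx pup0 pdown0 p1 ratio LM (s := 2 * pi).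
  by apply/andP; split; lra.
split; [exact: cvg1 | exact: cvg2 | move=> E]; move: lim1 lim2; rewrite -/phi E.
rewrite cospi mulr_natl cos2pi -[pi *+ 2]mulr_natl.
move: (complex.Re _) => c.
have : Num.sqrt (pi / (1 + 101 ^+ 2)) <= Num.sqrt (2 * pi / (1 + 101 ^+ 2) : R).
  apply: ler_wsqrtr; apply: ler_wpM2r; first by rewrite invr_ge0; exact: ltW D0.
  by lra.
have : 0 <= Num.sqrt (pi / (1 + 101 ^+ 2) : R) by exact: sqrtr_ge0.
set x := Num.sqrt _; set y := Num.sqrt _.
(* Only the order of the two square roots matters. *)
move: x y => x y.
rewrite !ler_norml => x0 xy /andP[h1 _] /andP[_ h2].
have c0 : 0 < c.
  rewrite ltNge; apply/negP => c0.
  have : c * x <= 0 by rewrite mulr_le0_ge0.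
  by lra.
have : c * x <= c * y by apply: ler_wpM2l xy; exact: ltW.
by lra.
Qed.
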